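(* Let $(\mathcal{V},\otimes)$ be a quantale whose underlying lattice is a frame, and let $X$ be a $\mathcal{V}$-graph which is a $(\mathcal{V},\otimes)$-category. Then for each $r\in\mathcal{V}$ and $n\in\mathbb{N}$, $N_\otimes(X)(r)_n$ is the set of $(n+1)$-tuples $(x_0,\dots,x_n)$ of vertices of $X$ such that $\bigotimes_{1\le i\le n}X(x_{i-1},x_i)\le r$.
   Context: A frame is a complete lattice $\mathcal{V}$ in which finite meets distribute over arbitrary joins; it is viewed as a category with $s\to r$ iff $s$ is below or equal to $r$ in the lattice order. Convention: $r\le s$ means $s\to r$ in $\mathcal{V}$, so $\le$ is the opposite of the lattice order; $\inf$ is with respect to $\le$ (join in $\mathcal{V}$). The least element for $\le$ is $0$ (terminal in $\mathcal{V}$) and the greatest is $\infty$. A quantale $(\mathcal{V},\otimes)$ is such a lattice with a monoidal structure $\otimes$ (associative, order preserving) whose unit is $0$ and such that joins commute with $\otimes$ in each variable: $r\otimes\inf_is_i=\inf_i(r\otimes s_i)$ and $(\inf_is_i)\otimes r=\inf_i(s_i\otimes r)$. Empty tensor products are $0$. A $\mathcal{V}$-graph $X$ is a set of vertices with $X(a,b)\in\mathcal{V}$ for each ordered pair, $X(a,a)=0$. It is a $(\mathcal{V},\otimes)$-category when $X(a,c)\le X(a,b)\otimes X(b,c)$ for all vertices $a,b,c$. For a $\mathcal{V}$-graph $X$, the nerve $N_\otimes(X)$ is the functor from $\mathcal{V}^{\mathrm{op}}$ (order $\le$) to simplicial sets for which $N_\otimes(X)(r)_n$ is the set of tuples $(x_0,\dots,x_n)$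 of vertices for which there exist $(r_1,\dots,r_n)\in\mathcal{V}^n$ with $\bigotimes_{1\le i\le n}r_i\le r$ and $X(x_i,x_j)\le\bigotimes_{i+1\le k\le j}r_k$ for each $0\le i\le j\le n$; faces omit and degeneracies repeat a vertex, and $r\le s$ acts by inclusion. *)

(* Defs.v *)
From HB Require Import structures.
From mathcomp Require Import all_boot all_order.
From mathcomp Require Import boolp classical_sets.

Set Implicit Arguments.
Unset Strict Implicit.
Unset Printing Implicit Defensive.
Import Order.TTheory.

Declare Scope quantale_scope.
Local Open Scope classical_set_scope.
Local Open Scope order_scope.

(* Throughout, the MathComp order `s <= r` on V is the lattice order, i.e. it  *)
(* says that there is a morphism s -> r in V.  The opposite order is written   *)
(* `r <=v s`; its least element 0 is \top, its greatest element oo is \bot,    *)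
(* and infima for it are joins of the lattice.                                 *)

HB.mixin Record TBLattice_isComplete d (V : Type) of Order.TBLattice d V := {
  bigjoin : set V -> V;
  bigjoin_supremum : forall S : set V, supremums S (bigjoin S)
}.

#[short(type="completeLatticeType")]
HB.structure Definition CompleteLattice d :=
  {V of Order.TBLattice d V & TBLattice_isComplete d V}.

Definition is_frame d (V : completeLatticeType d) : Prop :=
  forall (x : V) (S : set V),
    x `&` bigjoin S = bigjoin [set x `&` s | s in S].

HB.mixin Record CompleteLattice_isQuantale d (V : Type)
    of CompleteLattice d V := {
  tens : V -> V -> V;
  tensA : associative tens;
  tens_le : forall r r' s s' : V,
    r <= r' -> s <= s' -> tens r s <= tens r' s';
  tens0l : left_id \top tens;
  tens0r : right_id \top tens;
  tens_bigjoinr : forall (r : V) (S : set V),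
    tens r (bigjoin S) = bigjoin [set tens r s | s in S];
  tens_bigjoinl : forall (S : set V) (r : V),
    tens (bigjoin S) r = bigjoin [set tens s r | s in S]
}.

#[short(type="quantaleType")]
HB.structure Definition Quantale d :=
  {V of CompleteLattice d V & CompleteLattice_isQuantale d V}.

HB.instance Definition _ d (V : quantaleType d) :=
  Monoid.isLaw.Build V \top (@tens d V) (@tensA d V) (@tens0l d V) (@tens0r d V).

Notation "r <=v s" := (Order.le s r) (at level 70, no associativity)
  : quantale_scope.
Notation "0v" := Order.top (at level 0) : quantale_scope.
Notation "r \ox s" := (tens r s) (at level 40, left associativity)
  : quantale_scope.
Notation "\bigox_ ( k < n | P ) F" := (\big[tens/Order.top]_(k < n | P%N) F)
  (at level 36, F at level 36, k, n at level 50,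
   format "\bigox_ ( k  <  n  |  P )  F") : quantale_scope.
Notation "\bigox_ ( k < n ) F" := (\big[tens/Order.top]_(k < n) F)
  (at level 36, F at level 36, k, n at level 50,
   format "\bigox_ ( k  <  n )  F") : quantale_scope.

Local Open Scope quantale_scope.

Record vgraph d (V : quantaleType d) := VGraph {
  vertex :> Type;
  hom : vertex -> vertex -> V;
  hom_refl : forall a, hom a a = 0v
}.

Definition is_vcategory d (V : quantaleType d) (X : vgraph V) : Prop :=
  forall a b c : X, hom a c <=v hom a b \ox hom b c.

(* A map theta : [m] -> [n] acts on (n+1)-tuples by reindexing; the coface and *)
(* codegeneracy maps act by omitting, resp. repeating, an entry.               *)
Definition pull (T : Type) m n (theta : 'I_m.+1 -> 'I_n.+1)
    (x : n.+1.-tuple T) : m.+1.-tuple T :=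
  [tuple tnth x (theta i) | i < m.+1].

Lemma pull_id (T : Type) n (x : n.+1.-tuple T) : pull id x = x.
Proof. by apply: eq_from_tnth => i; rewrite tnth_mktuple. Qed.

Lemma pull_comp (T : Type) l m n (phi : 'I_l.+1 -> 'I_m.+1)
    (theta : 'I_m.+1 -> 'I_n.+1) (x : n.+1.-tuple T) :
  pull (theta \o phi) x = pull phi (pull theta x).
Proof. by apply: eq_from_tnth => i; rewrite !tnth_mktuple. Qed.

(* The simplicial sets whose n-simplices are (n+1)-tuples of elements of T and *)
(* whose operators reindex tuples.                                             *)
Record tuple_sset (T : Type) := TupleSSet {
  simplices :> forall n : nat, set (n.+1.-tuple T);
  simplices_pull : forall m n (theta : 'I_m.+1 -> 'I_n.+1),
    (forall i j : 'I_m.+1, (i <= j)%N -> (theta i <= theta j)%N) ->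
    forall x : n.+1.-tuple T, simplices x -> simplices (pull theta x)
}.
Arguments simplices {T} t n _ : rename.

Section Nerve.
Context d (V : quantaleType d) (X : vgraph V).

(* The factors r_1, ..., r_n are stored in t from index 0, so the product over *)
(* i <= k < j is r_{i+1} \ox ... \ox r_j, in this order.                       *)
Definition nerve_simplices (r : V) (n : nat) : set (n.+1.-tuple X) :=
  [set x | exists t : n.-tuple V,
     \bigox_(k < n) tnth t k <=v r /\
     forall i j : 'I_n.+1, (i <= j)%N ->
       hom (tnth x i) (tnth x j) <=v \bigox_(k < n | i <= k < j) tnth t k].
Arguments nerve_simplices : clear implicits.

Let seg n (t : n.-tuple V) (a b : nat) : V :=
  \big[tens/0v]_(a <= k < b) nth 0v t k.

Let segE n (t : n.-tuple V) (i j : 'I_n.+1) :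
  \bigox_(k < n | i <= k < j) tnth t k = seg t i j.
Proof.
rewrite /seg (big_nat_widenl _ 0) // (big_nat_widen _ _ n) -1?ltnS //.
rewrite big_mkord; apply: eq_big => [k|k _]; first by rewrite andbC.
exact: tnth_nth.
Qed.

Let seg_full n (t : n.-tuple V) : \bigox_(k < n) tnth t k = seg t 0 n.
Proof. by rewrite /seg big_mkord; apply: eq_bigr => k _; apply: tnth_nth. Qed.

Let seg_cat n (t : n.-tuple V) a b c : (a <= b)%N -> (b <= c)%N ->
  seg t a c = seg t a b \ox seg t b c.
Proof. by move=> ab bc; rewrite /seg (big_cat_nat ab bc). Qed.

Let seg_sub n (t : n.-tuple V) a b : (a <= b)%N -> (b <= n)%N ->
  seg t a b <=v seg t 0 n.
Proof.
move=> ab bn; rewrite (seg_cat t (leq0n a) (leq_trans ab bn)) (seg_cat t ab bn).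
have := tens_le _ _ _ _ (lex1 (seg t 0 a))
  (tens_le _ _ _ _ (lexx (seg t a b)) (lex1 (seg t b n))).
by rewrite tens0l tens0r.
Qed.

Lemma nerve_simplices_pull (r : V) m n (theta : 'I_m.+1 -> 'I_n.+1) :
  (forall i j : 'I_m.+1, (i <= j)%N -> (theta i <= theta j)%N) ->
  forall x, nerve_simplices r n x -> nerve_simplices r m (pull theta x).
Proof.
move=> homo x [t [tr tx]].
pose th k : nat := theta (inord k).
have thh a b : (a <= b)%N -> (b <= m)%N -> (th a <= th b)%N.
  by move=> ab bm; apply: homo; rewrite !inordK ?ltnS // (leq_trans ab).
pose u := [tuple seg t (th k) (th k.+1) | k < m].
have uE a b : (a <= b)%N -> (b <= m)%N -> seg u a b = seg t (th a) (th b).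
  elim: b => [|b IH]; first by rewrite leqn0 => /eqP->; rewrite /seg !big_geq.
  rewrite leq_eqVlt => /orP[/eqP->|ab bm]; first by rewrite /seg !big_geq.
  have -> : seg u a b.+1 = seg u a b \ox nth 0v u b by rewrite /seg big_nat_recr.
  rewrite (IH ab (ltnW bm)) (seg_cat t (thh a b ab (ltnW bm)) (thh b _ (leqnSn b) bm)).
  by rewrite -[b in nth _ _ b]/(val (Ordinal bm)) -tnth_nth tnth_mktuple.
exists u; split.
  rewrite seg_full uE //; apply: le_trans tr _.
  rewrite seg_full; apply: (seg_sub t (thh 0 m isT (leqnn m))).
  exact: ltn_ord (theta (inord m)).
move=> i j ij; rewrite !tnth_mktuple segE (uE _ _ ij (ltn_ord j)).
by rewrite /th !inord_val -segE; apply: tx; apply: homo.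
Qed.

Definition nerve (r : V) : tuple_sset X := TupleSSet (@nerve_simplices_pull r).

Lemma nerve_incl (r s : V) (n : nat) : r <=v s -> nerve r n `<=` nerve s n.
Proof. by move=> rs x [t [tr tx]]; exists t; split=> //; apply: le_trans rs tr. Qed.

End Nerve.

(* Main.v *)
(* In a category, iterated triangle inequalities bound X(x_i, x_j) by the tensor
   of the consecutive homs, so these serve as r_k. Conversely, the condition for
   (k - 1, k) in the nerve says X(x_(k-1), x_k) <= r_k, and tensors are monotone. *)
Require Import Defs.
From mathcomp Require Import all_boot all_order.
From mathcomp Require Import boolp classical_sets.

Import Order.TTheory.
Local Open Scope classical_set_scope.
Local Open Scope quantale_scope.

(** Turns the filtered products over ordinals in the nerve into products over intervals of naturals,
    which allow induction. *)
Lemma big_ord_interval (R : Type) (idx : R) (op : Monoid.law idx) (n i j : nat)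
    (F : nat -> R) : (j <= n)%N ->
  \big[op/idx]_(k < n | (i <= k < j)%N) F k = \big[op/idx]_(i <= k < j) F k.
Proof.
move=> jn; rewrite (big_nat_widenl _ 0) // (big_nat_widen _ _ n) // big_mkord.
by apply: eq_bigl => k; rewrite andbC.
Qed.

Lemma le_bigox (d : Order.disp_t) (V : quantaleType d) (I : Type) (s : seq I)
    (P : pred I) (F G : I -> V) : (forall i, P i -> F i <=v G i) ->
  \big[tens/0v]_(i <- s | P i) F i <=v \big[tens/0v]_(i <- s | P i) G i.
Proof.
by move=> FG; apply: (big_ind2 (fun a b : V => a <=v b)) => // *; apply: tens_le.
Qed.

(** Induction on [j - i]: the triangle inequality splits off the last edge, and the empty path uses
    X(a,a) = 0. *)
Lemma vcategory_hom_path (d : Order.disp_t) (V : quantaleType d) (X : vgraph V)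
    (x : nat -> X) (i j : nat) : is_vcategory X -> (i <= j)%N ->
  hom (x i) (x j) <=v \big[tens/0v]_(i <= k < j) hom (x k) (x k.+1).
Proof.
move=> hX /subnKC <-; elim: (j - i)%N => [|m IH].
  by rewrite addn0 big_geq // hom_refl.
rewrite addnS big_nat_recr ?leq_addr //=.
by apply: le_trans (hX _ (x (i + m)%N) _); apply: tens_le.
Qed.

Theorem corollary19 (d : Order.disp_t) (V : quantaleType d)
    (hV : is_frame V) (X : vgraph V) (hX : is_vcategory X) (r : V) (n : nat) :
  nerve X r n =
  [set x : n.+1.-tuple X |
    \bigox_(k < n) hom (tnth x (inord k)) (tnth x (inord k.+1)) <=v r].
Proof.
apply/seteqP; split=> x /= [].
  move=> t [tr tx]; apply: le_trans tr _; apply: le_bigox => k _.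
  have kn : (k < n.+1)%N := ltnW (ltn_ord k).
  have := tx (inord k) (inord k.+1).
  rewrite !inordK ?ltnS ?ltn_ord // => /(_ (leqnSn k)).
  (* Only [l = k] satisfies k <= l < k + 1, so the product is a single factor. *)
  by rewrite (big_pred1 k) // => l; rewrite /= ltnS -eqn_leq eq_sym.
(* [p] extends the tuple to all naturals; its values beyond [n] are dummies that never enter the
   products. *)
move=> xr; pose p k := tnth x (inord k).
exists [tuple hom (p k) (p k.+1) | k < n]; split.
  by under eq_bigr do rewrite tnth_mktuple.
move=> i j ij; under eq_bigr do rewrite tnth_mktuple.
rewrite (@big_ord_interval _ _ _ _ _ _ (fun k => hom (p k) (p k.+1))) -1?ltnS //.
by have := vcategory_hom_path _ _ _ p i j hX ij; rewrite /p !inord_val.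
Qed.
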